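(* History preserving bisimilarity $\approx_{h}$ (fully concurrent bisimilarity $\approx_{fcb}$) does not respect inevitability: there exist nets $N_1$ and $N_2$ with $N_1\approx_{fcb}N_2$ and an action $b$ that is inevitable in one of them but not in the other.
   Context: Petri nets: $N=(S,T,F,M_0,A,\ell)$ with disjoint sets $S$ (places), $T$ (transitions), $F:(S\times T)\cup(T\times S)\to\mathbb N$, initial marking $M_0\in\mathbb N^S$, type $A$, labelling $\ell:T\to A$; ${}^\bullet x(y)=F(y,x)$, $x^\bullet(y)=F(x,y)$; $t$ enabled at $M$ iff ${}^\bullet t\le M$, firing yields $M-{}^\bullet t+t^\bullet$; reachable markings arise from $M_0$ by finite firing sequences. A net is a Petri net with bounded parallelism (no reachable $M$ and multiset $U$ of transitions with infinitely many elements with $\sum_{t\in U}{}^\bullet t\le M$). Processes: a causal net is a net $\mathcal N=(\mathcal S,\mathcal T,\mathcal F,\mathcal M_0,\mathcal A,\ell_{\mathcal N})$ in which every place has at most one pre- and at most one post-transition, $\mathcal M_0(s)=1$ iff $s$ has no pre-transition (else 0), the transitive closure $\mathcal F^+$ of the flow is irreflexive, and every transition has finitely many $\mathcal F^+$-predecessor transitions. A folding into $N$ maps places to places, transitions to transitions, with $\mathcal A=A$, labels preserved, $\rho(\mathcal M_0)=M_0$, $\rho({}^\bullet t)={}^\bullet\rho(t)$, $\rho(t^\bullet)=\rho(t)^\bullet$ (where $\rho(H)(s)=|\rho^{-1}(s)\cap H|$). A process is a pair (causal net, folding); finite if it has finitely many transitions. $\mathcal P'\le\mathcal P$ ($\mathcal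 P$ extends $\mathcal P'$) iff the places and transitions of $\mathcal P'$ are subsets of those of $\mathcal P$, initial markings coincide, and the flow and folding of $\mathcal P'$ are restrictions of those of $\mathcal P$. An order-isomorphism between causal nets $\mathcal N_1,\mathcal N_2$ is a bijection $\beta$ between their transition sets, with equal types, preserving labels, such that $t\mathcal F_1^+u\iff\beta(t)\mathcal F_2^+\beta(u)$. A fully concurrent bisimulation between nets $N_1,N_2$ is a set $\mathcal R$ of triples $(\mathcal P_1,\beta,\mathcal P_2)$ with $\mathcal P_i=(\mathcal N_i,\rho_i)$ a finite process of $N_i$ and $\beta$ an order-isomorphism between $\mathcal N_1,\mathcal N_2$, such that $\mathcal R$ contains a triple with $\mathcal N_1$ having no transitions, and whenever $(\mathcal P_1,\beta,\mathcal P_2)\in\mathcal R$, $i\in\{1,2\}$ and $\mathcal P_i'$ is a finite process of $N_i$ extending $\mathcal P_i$, then $N_j$ ($j=3-i$) has a process $\mathcal P_j'\ge\mathcal P_j$ with $(\mathcal P_1',\beta',\mathcal P_2')\in\mathcal R$ for some $\beta'\supseteq\beta$. $N_1\approx_{fcb}N_2$ iff such a bisimulation exists. Inevitability (assuming justness but no fairness): a process is complete iff it has no proper extension. Action $b$ is inevitable in $N$ iff every complete process of $N$ contains a transition labelled $b$. An equivalence $\approx$ respects inevitability iff whenever $N_1\approx N_2$ and $b$ is inevitable in $N_1$, then $b$ is inevitable in $N_2$. *)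

(* Defs.v *)
From Stdlib Require Import Arith List FinFun Finite_sets Relation_Operators.

Set Implicit Arguments.
Unset Strict Implicit.

(* The type of a net (its set of actions) is the parameter [A], so two nets of
   equal type are two inhabitants of [petri_net A].  Disjointness of places and
   transitions is by typing; the flow F is split into [pre t s] = F(s,t) and
   [post t s] = F(t,s). *)
Record petri_net (A : Type) : Type := PetriNet {
  place : Type;
  trans : Type;
  pre   : trans -> place -> nat;
  post  : trans -> place -> nat;
  init  : place -> nat;
  label : trans -> A
}.

Arguments pre {A p} _ _.
Arguments post {A p} _ _.
Arguments init {A} _ _.
Arguments label {A p} _.

Section PetriNet.
Context {A : Type}.

Definition enabled (N : petri_net A) (M : place N -> nat) (t : trans N) : Prop :=
  forall s, pre t s <= M s.

Definition fire (N : petri_net A) (M : place N -> nat) (t : trans N) :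
    place N -> nat :=
  fun s => M s - pre t s + post t s.

Inductive reachable (N : petri_net A) : (place N -> nat) -> Prop :=
| reachable_init : reachable (init N)
| reachable_fire M t : reachable M -> enabled M t -> reachable (fire M t).

(* U is a possibly infinite multiset, so the sum of the presets of its elements
   may be infinite at a place; it is bounded by M iff every partial sum over
   finitely many distinct transitions is. *)
Definition concurrently_enabled (N : petri_net A) (M : place N -> nat)
    (U : trans N -> nat) : Prop :=
  forall (s : place N) (l : list (trans N)), NoDup l ->
    list_sum (map (fun t => U t * pre t s) l) <= M s.

Definition bounded_parallelism (N : petri_net A) : Prop :=
  ~ exists (M : place N -> nat) (U : trans N -> nat),
      reachable M /\ ~ Finite (trans N) (fun t => 0 < U t) /\
      concurrently_enabled M U.

End PetriNet.

Record net (A : Type) : Type := Net {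
  net_petri :> petri_net A;
  net_bounded : bounded_parallelism net_petri
}.

Section Processes.
Context {A : Type}.

Definition flow (N : petri_net A) (x y : place N + trans N) : Prop :=
  match x, y with
  | inl s, inr t => 0 < pre t s
  | inr t, inl s => 0 < post t s
  | _, _ => False
  end.

Definition flow_plus (N : petri_net A) : place N + trans N -> place N + trans N -> Prop :=
  clos_trans _ (@flow N).

(* The first four fields say that the multisets of pre- and of post-transitions
   of a place have at most one element, counted with arc weights. *)
Record causal_net (N : net A) : Prop := CausalNet {
  causal_pre_weight  : forall (t : trans N) s, post t s <= 1;
  causal_pre_unique  : forall (t u : trans N) s, 0 < post t s -> 0 < post u s -> t = u;
  causal_post_weight : forall (t : trans N) s, pre t s <= 1;
  causal_post_unique : forall (t u : trans N) s, 0 < pre t s -> 0 < pre u s -> t = u;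
  causal_init1 : forall s, (forall t : trans N, post t s = 0) -> init N s = 1;
  causal_init0 : forall s, (exists t : trans N, 0 < post t s) -> init N s = 0;
  causal_irrefl : forall x, ~ flow_plus (N := N) x x;
  causal_finite_past : forall t : trans N,
    Finite (trans N) (fun u => flow_plus (N := N) (inr u) (inr t))
}.

(* [image_mult rho H s n]: the multiset rho(H) has multiplicity n at s.
   The multisets H this is used for (initial marking, presets and postsets of a
   causal net) are 0/1-valued, hence sets. *)
Definition image_mult (X Y : Type) (rho : X -> Y) (H : X -> nat) (s : Y) (n : nat) : Prop :=
  cardinal X (fun x => rho x = s /\ 0 < H x) n.

Record folding (C N : net A) (rhoS : place C -> place N) (rhoT : trans C -> trans N) :
    Prop := Folding {
  folding_label : forall t, label t = label (rhoT t);
  folding_init : forall s, image_mult rhoS (init C) s (init N s);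
  folding_pre  : forall t s, image_mult rhoS (pre t) s (pre (rhoT t) s);
  folding_post : forall t s, image_mult rhoS (post t) s (post (rhoT t) s)
}.

Record process (N : net A) : Type := Process {
  proc_net :> net A;
  foldS : place proc_net -> place N;
  foldT : trans proc_net -> trans N;
  proc_causal : causal_net proc_net;
  proc_folding : folding foldS foldT
}.

Definition finite_process (N : net A) (P : process N) : Prop :=
  Finite (trans P) (fun _ => True).

(* [extension P Q]: Q extends P.  The carriers of P and Q being types, the
   inclusions of places and transitions are given as injections. *)
Record extension (N : net A) (P Q : process N) : Type := Extension {
  extS : place P -> place Q;
  extT : trans P -> trans Q;
  extS_inj : Injective extS;
  extT_inj : Injective extT;
  ext_init : forall s, init Q (extS s) = init P s;
  ext_init_out : forall s', 0 < init Q s' -> exists s, extS s = s';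
  ext_pre  : forall t s, pre (extT t) (extS s) = pre t s;
  ext_post : forall t s, post (extT t) (extS s) = post t s;
  ext_foldS : forall s, foldS (extS s) = foldS s;
  ext_foldT : forall t, foldT (extT t) = foldT t
}.

Definition proper (N : net A) (P Q : process N) (e : extension P Q) : Prop :=
  ~ (Surjective (extS e) /\ Surjective (extT e)).

Definition complete (N : net A) (P : process N) : Prop :=
  ~ exists (Q : process N) (e : extension P Q), proper e.

Definition inevitable (N : net A) (b : A) : Prop :=
  forall P : process N, complete P -> exists t : trans P, label t = b.

Definition order_isomorphism (C1 C2 : net A) (beta : trans C1 -> trans C2) : Prop :=
  Bijective beta /\
  (forall t, label (beta t) = label t) /\
  (forall t u, flow_plus (N := C1) (inr t) (inr u) <->
               flow_plus (N := C2) (inr (beta t)) (inr (beta u))).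

(* beta <= beta', along the inclusions e1 and e2. *)
Definition extends_iso (N1 N2 : net A) (P1 Q1 : process N1) (P2 Q2 : process N2)
    (e1 : extension P1 Q1) (e2 : extension P2 Q2)
    (beta : trans P1 -> trans P2) (beta' : trans Q1 -> trans Q2) : Prop :=
  forall t, beta' (extT e1 t) = extT e2 (beta t).

Record fc_bisimulation (N1 N2 : net A)
    (R : forall (P1 : process N1) (P2 : process N2), (trans P1 -> trans P2) -> Prop) :
    Prop := FcBisimulation {
  fcb_triple : forall P1 P2 beta, R P1 P2 beta ->
    finite_process P1 /\ finite_process P2 /\ order_isomorphism (C1 := P1) (C2 := P2) beta;
  fcb_init : exists P1 P2 beta, R P1 P2 beta /\ ~ inhabited (trans P1);
  fcb_forth : forall P1 P2 beta, R P1 P2 beta ->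
    forall (Q1 : process N1) (e1 : extension P1 Q1), finite_process Q1 ->
    exists (Q2 : process N2) (e2 : extension P2 Q2) (beta' : trans Q1 -> trans Q2),
      R Q1 Q2 beta' /\ extends_iso e1 e2 beta beta';
  fcb_back : forall P1 P2 beta, R P1 P2 beta ->
    forall (Q2 : process N2) (e2 : extension P2 Q2), finite_process Q2 ->
    exists (Q1 : process N1) (e1 : extension P1 Q1) (beta' : trans Q1 -> trans Q2),
      R Q1 Q2 beta' /\ extends_iso e1 e2 beta beta'
}.

Definition fcb (N1 N2 : net A) : Prop :=
  exists R : forall (P1 : process N1) (P2 : process N2), (trans P1 -> trans P2) -> Prop,
    fc_bisimulation R.

End Processes.

Definition respects_inevitability
    (eqv : forall A : Type, net A -> net A -> Prop) : Prop :=
  forall (A : Type) (N1 N2 : net A) (b : A),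
    eqv A N1 N2 -> inevitable N1 b -> inevitable N2 b.

(* Main.v *)
(** A token moves along [Chain 0], [Chain 1], ...; it is moved by a non-bell
    transition [Step i x], which for some choices of [x] also consumes (steals)
    the token on [Guard i].  A single bell can be rung, by any [Bell i] whose
    guard is still there.  If no step steals, a bell stays enabled until rung,
    so it is inevitable; if stealing is possible, the infinite run that steals
    every guard disables all bells.  A finite process, however, steals only
    finitely many guards and can always be continued by a step that does not
    steal, so its future depends only on which levels (steps [i], or the bell)
    already occurred; the bell is causally independent of the chain of steps.
    Hence matching transitions of equal level is a fully concurrent
    bisimulation between the nets with and without stealing. *)

From Stdlib Require Import Arith Lia List FinFun Finite_sets_facts Relation_Operators Operators_Properties.
From Stdlib Require Import ClassicalEpsilon FunctionalExtensionality PropExtensionality ProofIrrelevance.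
Require Import Defs.

Set Implicit Arguments.
Unset Strict Implicit.

(** * Finite sets and small cardinalities *)

Lemma ensemble_ext (T : Type) (S S' : T -> Prop) : (forall x, S x <-> S' x) -> S = S'.
Proof.
intros H; apply functional_extensionality; intros x.
now apply propositional_extensionality.
Qed.

Lemma cardinal_0 (T : Type) (S : T -> Prop) : cardinal T S 0 <-> forall x, ~ S x.
Proof.
split; intros H.
- intros x Hx; pose proof (cardinal_invert _ _ _ H) as E; simpl in E.
  rewrite E in Hx; destruct Hx.
- replace S with (Empty_set T); [constructor|].
  apply ensemble_ext; intros x; split; intros Hx; [destruct Hx | now destruct (H x)].
Qed.

Lemma cardinal_1 (T : Type) (S : T -> Prop) :
  cardinal T S 1 <-> exists x, forall y, S y <-> y = x.
Proof.
split.
- intros H; destruct (cardinal_invert _ _ _ H) as (S0 & x & E & _ & H0).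
  pose proof (cardinal_invert _ _ _ H0) as E0; simpl in E0; subst S0 S.
  exists x; intros y; split.
  + intros [z [] | z Hz]; now destruct Hz.
  + intros ->; right; constructor.
- intros [x Hx]; replace S with (Add T (Empty_set T) x).
  + constructor; [constructor | intros []].
  + apply ensemble_ext; intros y; rewrite Hx; split.
    * intros [z [] | z Hz]; now destruct Hz.
    * intros ->; right; constructor.
Qed.

Lemma Finite_sub (T : Type) (S S' : T -> Prop) :
  Finite T S -> (forall x, S' x -> S x) -> Finite T S'.
Proof.
intros H; revert S'; induction H as [|S H IH x Hx]; intros S' HS.
- replace S' with (Empty_set T); [constructor|].
  apply ensemble_ext; intros y; split; [intros [] | apply HS].
- destruct (classic (S' x)) as [Sx | Sx].
  + replace S' with (Add T (fun y => S' y /\ y <> x) x).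
    * constructor; [| now intros []].
      apply IH; intros y [Hy ne]; destruct (HS _ Hy) as [z Hz | z Hz]; [easy|].
      now destruct Hz.
    * apply ensemble_ext; intros y; split.
      -- intros [z Hz | z Hz]; [apply Hz | now destruct Hz].
      -- intros Hy; destruct (classic (y = x)) as [-> | ne];
           [right; constructor | left; now split].
  + apply IH; intros y Hy; destruct (HS _ Hy) as [z Hz | z Hz]; [easy|].
    now destruct Hz.
Qed.

(** Induction on the finite target set: the point added last has at most one preimage in [S]. *)
Lemma Finite_inj (T Y : Type) (f : T -> Y) (S' : Y -> Prop) (S : T -> Prop) :
  Finite Y S' -> (forall t, S t -> S' (f t)) ->
  (forall t u, S t -> S u -> f t = f u -> t = u) -> Finite T S.
Proof.
intros H; revert S; induction H as [|S' H IH y Hy]; intros S HS inj.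
- replace S with (Empty_set T); [constructor|].
  apply ensemble_ext; intros t; split; [intros [] | intros Ht; destruct (HS _ Ht)].
- assert (F : Finite T (fun t => S t /\ f t <> y)).
  { apply IH.
    - intros t [Ht ne]; destruct (HS _ Ht) as [z Hz | z Hz]; [easy | now destruct Hz].
    - intros t u [Ht _] [Hu _]; now apply inj. }
  destruct (classic (exists t, S t /\ f t = y)) as [[t0 [Ht0 E]] | N].
  + apply Finite_sub with (Add T (fun t => S t /\ f t <> y) t0).
    * constructor; [exact F | now intros []].
    * intros t Ht; destruct (classic (f t = y)) as [Et | Et]; [right | left; now split].
      rewrite (inj t t0); [constructor | easy | easy | congruence].
  + apply Finite_sub with (1 := F); intros t Ht; split; [easy|].
    intros E; apply N; now exists t.
Qed.

Lemma Finite_lt (n : nat) : Finite nat (fun k => k < n).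
Proof.
induction n as [|n IH].
- replace (fun k => k < 0) with (Empty_set nat); [constructor|].
  apply ensemble_ext; intros k; split; [intros [] | lia].
- apply Finite_sub with (Add nat (fun k => k < n) n).
  + constructor; [exact IH | unfold In; lia].
  + intros k Hk; destruct (Nat.eq_dec k n) as [-> | ne]; [right; constructor | left].
    unfold In; lia.
Qed.

Lemma Finite_bounded (T : Type) (S : T -> Prop) (f : T -> nat) :
  Finite T S -> exists n, forall t, S t -> f t < n.
Proof.
induction 1 as [|S H [n IH] x Hx].
- exists 0; intros t [].
- exists (Nat.max n (Datatypes.S (f x))); intros t [z Hz | z Hz].
  + specialize (IH _ Hz); lia.
  + destruct Hz; lia.
Qed.

(** * The clock nets and their bounded parallelism *)

Inductive site := Chain (i : nat) | Guard (i : nat) | Lock.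

Inductive event (X : Type) := Step (i : nat) (x : X) | Bell (i : nat).
Arguments Bell {X} i.

Section Clock.
Variables (X : Type) (steals : X -> bool).

Definition clock_pre (t : event X) (s : site) : nat :=
  match t, s with
  | Step i _, Chain j => if i =? j then 1 else 0
  | Step i x, Guard j => if steals x then if i =? j then 1 else 0 else 0
  | Bell i, Guard j => if i =? j then 1 else 0
  | Bell _, Lock => 1
  | _, _ => 0
  end.

Definition clock_post (t : event X) (s : site) : nat :=
  match t, s with
  | Step i _, Chain j => if S i =? j then 1 else 0
  | _, _ => 0
  end.

Definition clock_init (s : site) : nat :=
  match s with Chain (S _) => 0 | _ => 1 end.

Definition is_bell (t : event X) : bool :=
  match t with Bell _ => true | _ => false end.

(** All bells share level 0 because they compete for the token on [Lock]; likewise all [Step i x]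
    compete for the one on [Chain i]. So a level is a conflict class. *)
Definition level (t : event X) : nat :=
  match t with Step i _ => S i | Bell _ => 0 end.

Definition clock_petri : petri_net bool :=
  PetriNet clock_pre clock_post clock_init is_bell.

Lemma clock_pre_le1 t s : clock_pre t s <= 1.
Proof.
destruct t as [i x | i], s as [j | j |]; simpl; try destruct (steals x);
  try destruct (Nat.eqb_spec i j); lia.
Qed.

Lemma clock_post_le1 t s : clock_post t s <= 1.
Proof.
destruct t as [i x | i], s as [[|j] | j |]; simpl; try destruct (Nat.eqb_spec i j); lia.
Qed.

Lemma clock_init_le1 s : clock_init s <= 1.
Proof. destruct s as [[|j] | j |]; simpl; lia. Qed.

Lemma clock_post_pos t s :
  0 < clock_post t s -> exists i x, t = Step i x /\ s = Chain (S i).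
Proof.
destruct t as [i x | i], s as [j | j |]; cbn [clock_post]; try lia.
destruct (Nat.eqb_spec (S i) j); [|lia]; subst; eauto.
Qed.

Lemma clock_init_pos s : 0 < clock_init s <-> forall i, s <> Chain (S i).
Proof.
destruct s as [[|j] | j |]; simpl; split; try lia; try (intros; discriminate).
intros H; now destruct (H j).
Qed.

Lemma clock_pre_chain t i : 0 < clock_pre t (Chain i) <-> level t = S i.
Proof.
destruct t as [j x | j]; simpl; [|lia]; destruct (Nat.eqb_spec j i); lia.
Qed.

Lemma clock_pre_lock t : 0 < clock_pre t Lock <-> level t = 0.
Proof. destruct t; simpl; lia. Qed.

(** Together with the odd rank [2 * level t + 1] of a transition, this numbering increases strictly
    along the flow. It yields acyclicity and finite pasts of causal nets. *)
Definition site_rank (s : site) : nat :=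
  match s with Chain i => 2 * i + 2 | _ => 0 end.

Lemma clock_pre_rank t s : 0 < clock_pre t s -> site_rank s < 2 * level t + 1.
Proof.
destruct t as [i x | i], s as [j | j |]; simpl; try lia;
  destruct (Nat.eqb_spec i j); lia.
Qed.

Lemma clock_post_rank t s : 0 < clock_post t s -> 2 * level t + 1 < site_rank s.
Proof. intros H; destruct (clock_post_pos H) as (i & x & -> & ->); simpl; lia. Qed.

(* [cap i] bounds the markings reached when the chain token is at [Chain i]. *)
Definition cap (i : nat) (s : site) : nat :=
  match s with Chain j => if j =? i then 1 else 0 | _ => 1 end.

(** Stated for a net [K] over the clock, so that it serves the clock itself and the causal nets
    built below. A reachable marking has at most one token per place and at most one on the chain,
    so at most one bell and one step can fire concurrently. *)
Lemma bounded_parallelism_sub (K : petri_net bool) (f : place K -> site)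
    (g : trans K -> event X) :
  (forall t s, pre t s = clock_pre (g t) (f s)) ->
  (forall t s, post t s = clock_post (g t) (f s)) ->
  (forall s, init K s = clock_init (f s)) ->
  (forall t s, 0 < clock_pre (g t) s -> exists s', f s' = s) ->
  bounded_parallelism K.
Proof.
intros Hpre Hpost Hinit Hex (M & U & reach & inf & conc).
assert (HM : exists i, forall s, M s <= cap i (f s)).
{ clear conc inf; induction reach as [|M t reach [i IH] en].
  - exists 0; intros s; rewrite Hinit; destruct (f s) as [[|j] | j |]; simpl; lia.
  - destruct (g t) as [k x | k] eqn:E.
    + exists (S k); intros s; unfold fire; rewrite Hpre, Hpost, E.
      (* Firing [Step k x] needs a token on [Chain k], but the only chain token is on [Chain i]. *)
      assert (k = i) as ->.
      { destruct (Hex t (Chain k)) as [s' Es].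
        { now apply clock_pre_chain; rewrite E. }
        generalize (en s') (IH s'); rewrite Hpre, E, Es; simpl.
        rewrite Nat.eqb_refl; destruct (Nat.eqb_spec k i); lia. }
      specialize (IH s); destruct (f s) as [j | j |];
        cbn [clock_pre clock_post cap] in *; try lia.
      destruct (Nat.eqb_spec i j), (Nat.eqb_spec j i), (Nat.eqb_spec (S i) j),
        (Nat.eqb_spec j (S i)); lia.
    + exists i; intros s; unfold fire; rewrite Hpost, E; specialize (IH s).
      destruct (f s); simpl; simpl in IH; lia. }
destruct HM as [i HM].
(* Two distinct elements of [U] with a common preplace would need two tokens there. *)
assert (share : forall t u s, 0 < U t -> 0 < U u -> 0 < clock_pre (g t) s ->
          0 < clock_pre (g u) s -> t = u).
{ intros t u s Ut Uu Pt Pu; destruct (classic (t = u)) as [|ne]; [easy|].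
  destruct (Hex _ _ Pt) as [s' Es].
  assert (nd : NoDup (t :: u :: nil)).
  { constructor; [intros [e | []]; congruence|].
    constructor; [intros [] | constructor]. }
  generalize (conc s' _ nd) (HM s'); simpl; rewrite !Hpre, Es.
  assert (cap i s <= 1) by (destruct s as [j | j |]; simpl; try destruct (j =? i); lia).
  destruct (U t), (U u), (clock_pre (g t) s), (clock_pre (g u) s); simpl; lia. }
assert (lev : forall t, 0 < U t -> level (g t) = 0 \/ level (g t) = S i).
{ intros t Ut; destruct (level (g t)) as [|k] eqn:E; [now left | right].
  assert (Pk := E); apply clock_pre_chain in Pk; destruct (Hex _ _ Pk) as [s' Es].
  assert (nd : NoDup (t :: nil)) by (constructor; [intros [] | constructor]).
  generalize (conc s' _ nd) (HM s'); simpl; rewrite Hpre, Es; simpl.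
  destruct (Nat.eqb_spec k i) as [-> |]; [easy|].
  destruct (U t), (clock_pre (g t) (Chain k)); simpl; lia. }
apply inf.
apply (Finite_inj (f := fun t => level (g t))) with (1 := Finite_lt (S (S i))).
- intros t Ut; destruct (lev _ Ut); lia.
- intros t u Ut Uu E; destruct (level (g t)) as [|k] eqn:Et.
  + apply share with Lock; rewrite ?clock_pre_lock; congruence.
  + apply share with (Chain k); rewrite ?clock_pre_chain; congruence.
Qed.

Definition clock : net bool.
Proof.
exists clock_petri.
apply (bounded_parallelism_sub (K := clock_petri) (f := fun s => s) (g := fun t => t));
  simpl; eauto.
Defined.

(** * Structure of the processes of a clock *)

Section Process.
Variable P : process clock.

Let CP : causal_net P := proc_causal P.
Let FP : folding (C := P) (foldS (p := P)) (foldT (p := P)) := proc_folding P.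

Definition lev (t : trans P) : nat := level (foldT t).

(** For 0/1-valued [h] the multiset equations of a folding reduce to a bijection between supports,
    which replaces cardinalities by existence and uniqueness. *)
Lemma image_mult_pos (H : place P -> nat) (h : site -> nat) :
  (forall s, h s <= 1) ->
  (forall s, image_mult (Y := place clock) (foldS (p := P)) H s (h s)) ->
  (forall s, 0 < H s -> 0 < h (foldS s)) /\
  (forall s, 0 < h s -> exists c : place P, foldS c = s /\ 0 < H c /\
     forall c' : place P, foldS c' = s -> 0 < H c' -> c' = c).
Proof.
intros h1 im; split.
- intros c Hc; specialize (im (foldS c)); destruct (h (foldS c)); [|lia].
  destruct (proj1 (cardinal_0 _) im c); split; auto.
- intros s hs; specialize (im s).
  assert (E : h s = 1) by (specialize (h1 s); lia); rewrite E in im.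
  destruct (proj1 (cardinal_1 _) im) as [c Hc].
  destruct (proj2 (Hc c) eq_refl) as [c1 c2].
  exists c; repeat split; auto; intros c' E' H'; now apply Hc.
Qed.

Definition fold_pre (t : trans P) :=
  image_mult_pos (clock_pre_le1 (foldT t)) (folding_pre FP t).
Definition fold_post (t : trans P) :=
  image_mult_pos (clock_post_le1 (foldT t)) (folding_post FP t).
Definition fold_init := image_mult_pos clock_init_le1 (folding_init FP).

Lemma init_or_produced (c : place P) :
  0 < init P c \/ exists t : trans P, 0 < post t c.
Proof.
destruct (classic (exists t : trans P, 0 < post t c)) as [|N]; [now right | left].
rewrite (causal_init1 CP); [lia|].
intros t; destruct (post t c) eqn:E; [easy|]; destruct N; exists t; lia.
Qed.

Lemma init_not_chain (c : place P) :
  (forall i, foldS c <> Chain (S i)) -> 0 < init P c.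
Proof.
intros H; destruct (init_or_produced c) as [|[t Ht]]; [easy|].
apply fold_post in Ht; destruct (clock_post_pos Ht) as (i & _ & _ & E).
now destruct (H i).
Qed.

Lemma produced_chain (c : place P) i : foldS c = Chain (S i) ->
  exists t : trans P, 0 < post t c /\ lev t = S i.
Proof.
intros E; destruct (init_or_produced c) as [H | [t H]].
- apply fold_init in H; rewrite E in H; simpl in H; lia.
- exists t; split; [easy|]; apply fold_post in H; rewrite E in H.
  destruct (clock_post_pos H) as (j & x & E1 & E2); unfold lev; rewrite E1; simpl.
  now injection E2 as ->.
Qed.

(** Sites other than [Chain (S i)] are never produced, so their places are initial, hence unique.
    Along the chain, uniqueness propagates: producers of two places over [Chain (S i)] consume the
    same place over [Chain i], so they coincide, and one transition has only one postplace over
    [Chain (S i)]. *)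
Lemma foldS_inj : Injective (foldS (p := P)).
Proof.
assert (H : forall s (c c' : place P), foldS c = s -> foldS c' = s -> c = c').
{ intros s; destruct (classic (forall i, s <> Chain (S i))) as [H | H].
  - intros c c' E E'; destruct (proj2 fold_init s) as (d & _ & _ & u).
    { now apply clock_init_pos. }
    rewrite (u c), (u c'); auto; apply init_not_chain; congruence.
  - apply not_all_ex_not in H; destruct H as [i H]; apply NNPP in H; subst s.
    induction i as [i IH] using lt_wf_ind; intros c c' E E'.
    destruct (produced_chain E) as (t & Ht & Lt), (produced_chain E') as (u & Hu & Lu).
    destruct (proj2 (fold_pre t) (Chain i)) as (d & Ed & Hd & _).
    { now apply clock_pre_chain. }
    destruct (proj2 (fold_pre u) (Chain i)) as (d' & Ed' & Hd' & _).
    { now apply clock_pre_chain. }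
    assert (d = d') as <-.
    (* [Chain 0] is settled by the initial marking, the later ones by the induction hypothesis. *)
    { destruct i as [|i]; [|apply IH with i; [lia | easy | easy]].
      destruct (proj2 fold_init (Chain 0)) as (e & _ & _ & ue); [simpl; lia|].
      rewrite (ue d), (ue d'); auto; apply init_not_chain; congruence. }
    assert (t = u) as <- by now apply (causal_post_unique CP) with d.
    destruct (proj2 (fold_post t) (Chain (S i))) as (e & _ & _ & ue).
    { rewrite <- E; now apply fold_post. }
    rewrite (ue c), (ue c'); auto. }
intros c c' E; now apply H with (foldS c').
Qed.

(** A conflict in the clock becomes an equality here: by [foldS_inj] both transitions consume the
    same place, and places of a causal net do not branch forward. *)
Lemma fold_shared_pre (t u : trans P) s :
  0 < clock_pre (foldT t) s -> 0 < clock_pre (foldT u) s -> t = u.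
Proof.
intros Ht Hu.
destruct (proj2 (fold_pre t) s Ht) as (c & Ec & Hc & _).
destruct (proj2 (fold_pre u) s Hu) as (d & Ed & Hd & _).
assert (c = d) as <- by (apply foldS_inj; congruence).
now apply (causal_post_unique CP) with c.
Qed.

Lemma lev_inj (t u : trans P) : lev t = lev u -> t = u.
Proof.
intros E; destruct (lev t) as [|k] eqn:Et.
- apply fold_shared_pre with Lock; now apply clock_pre_lock.
- apply fold_shared_pre with (Chain k); now apply clock_pre_chain.
Qed.

Lemma lev_pred (t : trans P) i : lev t = S (S i) ->
  exists u, lev u = S i /\ flow_plus (N := P) (inr u) (inr t).
Proof.
intros E; destruct (proj2 (fold_pre t) (Chain (S i))) as (c & Ec & Hc & _).
{ now apply clock_pre_chain. }
destruct (produced_chain Ec) as (u & Hu & Lu); exists u; split; [easy|].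
apply t_trans with (inl c); now apply t_step.
Qed.

Lemma fold_step_post (t : trans P) i : lev t = S i ->
  exists c : place P, foldS c = Chain (S i).
Proof.
intros E; destruct (proj2 (fold_post t) (Chain (S i))) as (c & Ec & _).
{ unfold lev in E; destruct (foldT t) as [j x | j]; simpl in E; [|easy].
  injection E as ->; cbn; rewrite Nat.eqb_refl; lia. }
now exists c.
Qed.

(** Causality depends on levels only, whether or not steps steal: guards and the lock are never
    produced and a bell produces nothing, so the bell is isolated while the steps form a chain. *)
Lemma flow_plus_lev (t u : trans P) :
  flow_plus (N := P) (inr t) (inr u) <-> 0 < lev t < lev u.
Proof.
split.
- intros H.
  (* Induction over paths needs an invariant for paths ending in a place as well. *)
  enough (G : forall y, flow_plus (N := P) (inr t) y -> 0 < lev t /\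
    match y with
    | inl c => exists j, foldS c = Chain (S j) /\ lev t <= S j
    | inr v => lev t < lev v
    end) by now destruct (G _ H).
  clear u H; intros y H.
  apply clos_trans_tn1_iff in H.
  induction H as [y H | y z H _ [IH0 IH]].
  + destruct y as [c | v]; [|destruct H].
    apply fold_post in H; destruct (clock_post_pos H) as (i & x & E & E').
    unfold lev; rewrite E; simpl; split; [lia|]; now exists i.
  + split; [easy|]; destruct y as [c | v], z as [d | w]; simpl in H; try easy.
    * destruct IH as (j & E & L); apply fold_pre in H; rewrite E in H.
      apply clock_pre_chain in H; unfold lev in *; lia.
    * apply fold_post in H; destruct (clock_post_pos H) as (i & x & E & E').
      exists i; split; [easy|]; unfold lev in *; rewrite E in IH; simpl in IH; lia.
- intros [H0 H]; remember (lev u) as k eqn:E; revert u E.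
  induction k as [|k IH]; intros u E; [lia|].
  destruct k as [|k]; [lia|]; destruct (lev_pred (eq_sym E)) as (v & Ev & F).
  destruct (Nat.eq_dec (lev t) (S k)) as [Et | Et].
  + now rewrite (lev_inj (t := t) (u := v)) by congruence.
  + apply t_trans with (inr v); [apply IH; [lia | easy] | easy].
Qed.

End Process.

(** * Processes built from sets of transitions *)

(* In a process of the clock every place and every level occurs at most once, so
   a process amounts to the set [U] of transitions of the clock that it fires. *)
Section Canonical.
Variable U : event X -> Prop.
(** [U] has to be conflict-free and causally closed: no token on the lock or chain is consumed
    twice, every chain token consumed has been produced, and no guard is used by both a step and a
    bell. *)
Hypothesis U_level : forall t u, U t -> U u -> level t = level u -> t = u.
Hypothesis U_down : forall t i, U t -> level t = S (S i) -> exists u, U u /\ level u = S i.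
Hypothesis U_guard : forall i x, U (Step i x) -> U (Bell i) -> steals x = false.

(** A place over [Chain (S i)] without a producer would have to be marked initially in a causal net,
    so it is left out. *)
Definition available (s : site) : Prop :=
  match s with Chain (S i) => exists u, U u /\ level u = S i | _ => True end.

Definition canonical_petri : petri_net bool :=
  PetriNet (place := {s | available s}) (trans := {t | U t})
    (fun t s => clock_pre (proj1_sig t) (proj1_sig s))
    (fun t s => clock_post (proj1_sig t) (proj1_sig s))
    (fun s => clock_init (proj1_sig s))
    (fun t => is_bell (proj1_sig t)).

Lemma available_pre t s : U t -> 0 < clock_pre t s -> available s.
Proof.
destruct s as [[|i] | i |]; simpl; auto.
intros Ut H; apply clock_pre_chain in H; now apply U_down with t.
Qed.

Lemma available_post t s : U t -> 0 < clock_post t s -> available s.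
Proof.
intros Ut H; destruct (clock_post_pos H) as (i & x & -> & ->); simpl.
now exists (Step i x).
Qed.

Definition canonical_net : net bool.
Proof.
exists canonical_petri.
apply (bounded_parallelism_sub (K := canonical_petri) (f := @proj1_sig _ _)
         (g := @proj1_sig _ _)); simpl; auto.
intros [t Ut] s H; simpl in H; now exists (exist _ s (available_pre Ut H)).
Defined.

Lemma canonical_level (t u : trans canonical_net) :
  level (proj1_sig t) = level (proj1_sig u) -> t = u.
Proof.
destruct t as [t Ut], u as [u Uu]; simpl; intros E.
now apply subset_eq_compat, U_level.
Qed.

Definition canonical_rank (x : place canonical_net + trans canonical_net) : nat :=
  match x with
  | inl s => site_rank (proj1_sig s)
  | inr t => 2 * level (proj1_sig t) + 1
  end.

Lemma canonical_flow_rank x y :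
  flow_plus (N := canonical_net) x y -> canonical_rank x < canonical_rank y.
Proof.
induction 1 as [x y H | x y z _ IH1 _ IH2]; [|lia].
destruct x as [s | t], y as [s' | u]; cbn in H; try easy.
- now apply clock_pre_rank.
- now apply clock_post_rank.
Qed.

Lemma canonical_causal : causal_net canonical_net.
Proof.
split.
- intros t s; apply clock_post_le1.
- intros t u s Ht Hu; apply canonical_level.
  destruct (clock_post_pos Ht) as (i & x & -> & E).
  destruct (clock_post_pos Hu) as (j & y & -> & E'); simpl; congruence.
- intros t s; apply clock_pre_le1.
- intros [t Ut] [u Uu] [s Hs]; cbn; intros Ht Hu; apply subset_eq_compat.
  destruct s as [i | i |].
  + apply clock_pre_chain in Ht, Hu; apply U_level; congruence.
  + destruct t as [j x | j], u as [k y | k]; cbn in Ht, Hu;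
      try destruct (steals x) eqn:Sx; try destruct (steals y) eqn:Sy;
      destruct (Nat.eqb_spec j i); try lia; destruct (Nat.eqb_spec k i); try lia; subst.
    * now apply U_level.
    * now rewrite (U_guard Ut Uu) in Sx.
    * now rewrite (U_guard Uu Ut) in Sy.
    * easy.
  + apply clock_pre_lock in Ht, Hu; apply U_level; congruence.
- intros [s Hs] H; cbn.
  destruct s as [[|i] | i |]; simpl; try reflexivity.
  destruct Hs as (u & Uu & E); specialize (H (exist _ u Uu)); cbn in H.
  destruct u as [j x | j]; simpl in E; [|easy]; injection E as ->.
  simpl in H; rewrite Nat.eqb_refl in H; discriminate.
- intros s [t H]; destruct (clock_post_pos H) as (i & x & _ & E).
  cbn; now rewrite E.
- intros x H; apply canonical_flow_rank in H; lia.
(* Predecessors have smaller rank, hence smaller level, and levels are injective. *)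
- intros t.
  apply (Finite_inj (f := fun u : trans canonical_net => level (proj1_sig u)))
    with (1 := Finite_lt (level (proj1_sig t))).
  + intros u H; apply canonical_flow_rank in H; cbn in H; lia.
  + intros u v _ _; apply canonical_level.
Qed.

Lemma image_mult_proj1 (V : site -> Prop) (h : site -> nat) (s : site) :
  h s <= 1 -> (0 < h s -> V s) ->
  image_mult (X := {s | V s}) (@proj1_sig _ _) (fun c => h (proj1_sig c)) s (h s).
Proof.
intros h1 hV; unfold image_mult; destruct (h s) as [|[|k]] eqn:E; [| |lia].
- apply cardinal_0; intros c [<- H]; lia.
- apply cardinal_1; exists (exist _ s (hV (Nat.lt_0_succ _))); intros [c Hc]; simpl.
  split.
  + intros [-> _]; now apply subset_eq_compat.
  + intros e; injection e as ->; rewrite E; split; [easy | lia].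
Qed.

Lemma canonical_folding :
  folding (C := canonical_net) (N := clock) (@proj1_sig _ _) (@proj1_sig _ _).
Proof.
split.
- reflexivity.
- intros s; apply image_mult_proj1; [apply clock_init_le1|].
  destruct s as [[|i] | i |]; simpl; auto; lia.
- intros [t Ut] s; apply image_mult_proj1; [apply clock_pre_le1|].
  now apply available_pre.
- intros [t Ut] s; apply image_mult_proj1; [apply clock_post_le1|].
  now apply available_post.
Qed.

Definition canonical : process clock := Process canonical_causal canonical_folding.

Lemma available_image (P : process clock) (c : place P) :
  (forall t : trans P, U (foldT t)) -> available (foldS c).
Proof.
intros HU; destruct (foldS c) as [[|i] | i |] eqn:E; simpl; auto.
destruct (produced_chain E) as (t & _ & L); now exists (foldT t).
Qed.

(** The folding of [P] is itself the inclusion, being injective on places and transitions. Initial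
    marking and flow agree because they are 0/1-valued with matching supports. *)
Definition canonical_ext (P : process clock) (HU : forall t : trans P, U (foldT t)) :
  extension P canonical.
Proof.
exists (fun c => exist _ (foldS c) (available_image c HU))
  (fun t => exist _ (foldT t) (HU t)).
- intros c d E; injection E as E; now apply foldS_inj.
- intros t u E; injection E as E; apply lev_inj; unfold lev; congruence.
- intros c; cbn; destruct (init_or_produced c) as [H | [t H]].
  + assert (H' := proj1 (fold_init P) _ H); generalize (clock_init_le1 (foldS c)).
    destruct (classic (exists t : trans P, 0 < post t c)) as [N | N].
    * apply (causal_init0 (proc_causal P)) in N; lia.
    * rewrite (causal_init1 (proc_causal P)); [lia|].
      intros t; destruct (post t c) eqn:E; [easy|]; destruct N; exists t; lia.
  + rewrite (causal_init0 (proc_causal P)); [|now exists t].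
    apply fold_post in H; destruct (clock_post_pos H) as (i & x & _ & ->); reflexivity.
- intros [s Hs]; cbn; intros H; destruct (proj2 (fold_init P) s H) as (c & E & _).
  exists c; now apply subset_eq_compat.
- intros t c; cbn.
  generalize (clock_pre_le1 (foldT t) (foldS c)) (causal_post_weight (proc_causal P) t c).
  generalize (proj1 (fold_pre t) c) (proj2 (fold_pre t) (foldS c)).
  destruct (clock_pre (foldT t) (foldS c)) as [|[|]]; intros H1 H2; try lia.
  intros _; destruct H2 as (d & E & Hd & _); [lia|].
  apply foldS_inj in E; subst d; lia.
- intros t c; cbn.
  generalize (clock_post_le1 (foldT t) (foldS c)) (causal_pre_weight (proc_causal P) t c).
  generalize (proj1 (fold_post t) c) (proj2 (fold_post t) (foldS c)).
  destruct (clock_post (foldT t) (foldS c)) as [|[|]]; intros H1 H2; try lia.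
  intros _; destruct H2 as (d & E & Hd & _); [lia|].
  apply foldS_inj in E; subst d; lia.
- reflexivity.
- reflexivity.
Defined.

End Canonical.

(** * Growing processes, and inevitability of the bell *)

Variable x0 : X.
Hypothesis steals_x0 : steals x0 = false.

(* The new bell is [Bell m], and new steps do not steal their guards. *)
Lemma grow (P : process clock) (D : nat -> Prop) (m : nat) :
  (forall t : trans P, D (lev t)) ->
  (forall i, D (S (S i)) -> D (S i)) ->
  (forall (t : trans P) x, foldT t = Step m x -> steals x = false) ->
  exists (Q : process clock) (_ : extension P Q),
    forall k, D k <-> exists t : trans Q, lev t = k.
Proof.
intros DP Ddown Hm.
pose (new := fun t : event X => match t with Step _ x => x = x0 | Bell i => i = m end).
pose (U := fun t : event X => (exists u : trans P, foldT u = t) \/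
  (new t /\ D (level t) /\ ~ exists u : trans P, lev u = level t)).
assert (UD : forall k, D k <-> exists t, U t /\ level t = k).
{ intros k; split.
  - intros Dk; destruct (classic (exists u : trans P, lev u = k)) as [[u E] | N].
    + exists (foldT u); split; [left; now exists u | easy].
    + exists (match k with 0 => Bell m | S i => Step i x0 end).
      split; [right | now destruct k]; destruct k; simpl; auto.
  - intros (t & [[u <-] | (_ & Dt & _)] & <-); [apply DP | easy]. }
assert (U1 : forall t u, U t -> U u -> level t = level u -> t = u).
{ intros t u [[v <-] | (nt & _ & Nt)] [[w <-] | (nu & _ & Nu)] E.
  - f_equal; now apply lev_inj.
  - destruct Nu; now exists v.
  - destruct Nt; now exists w.
  - destruct t, u; simpl in *; try easy; congruence. }
assert (U2 : forall t i, U t -> level t = S (S i) -> exists u, U u /\ level u = S i).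
{ intros t i Ut E; apply UD, Ddown, UD; now exists t. }
assert (U3 : forall i x, U (Step i x) -> U (Bell i) -> steals x = false).
{ intros i x [[v Ev] | (nv & _)] [[w Ew] | (nw & _)]; simpl in *; try congruence.
  (* Both old: if the step stole, it would share [Guard i] with the bell and be equal to it. The
     other remaining case is an old step with the new bell, where [Hm] applies. *)
  - destruct (steals x) eqn:Sx; [|easy].
    assert (v = w) as <-; [|congruence].
    apply fold_shared_pre with (Guard i); rewrite ?Ev, ?Ew; simpl; rewrite ?Sx, Nat.eqb_refl; lia.
  - subst i; now apply Hm with v. }
exists (canonical U1 U2 U3), (canonical_ext U1 U2 U3 (fun t => or_introl (ex_intro _ t eq_refl))).
intros k; rewrite UD; split.
- intros (t & Ut & E); now exists (exist _ t Ut).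
- intros ([t Ut] & E); now exists t.
Qed.

Lemma no_stealing_inevitable :
  (forall x, steals x = false) -> inevitable clock true.
Proof.
intros NS P C; destruct (classic (exists t : trans P, lev t = 0)) as [[t E] | N].
- exists t; rewrite (folding_label (proc_folding P)); cbn.
  unfold lev in E; now destruct (foldT t).
(* Without a bell, adding level 0 gives a proper extension; [Bell 0] will do, since no guard is ever
   stolen. *)
- destruct (@grow P (fun k => k = 0 \/ exists t : trans P, lev t = k) 0)
    as (Q & e & HQ).
  + intros t; right; now exists t.
  + intros i [|[t E]]; [easy|]; right.
    destruct (lev_pred E) as (u & Eu & _); now exists u.
  + auto.
  + destruct C; exists Q, e; intros [_ sur].
    destruct (proj1 (HQ 0)) as [t E]; [now left|].
    destruct (sur t) as [u <-]; apply N; exists u.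
    unfold lev in *; now rewrite ext_foldT in E.
Qed.

(** The process firing all [Step i x1] is complete: an extension has no room for another step, as
    every positive level is taken, nor for [Bell i], which would share [Guard i] with
    [Step i x1]. *)
Lemma stealing_not_inevitable x1 : steals x1 = true -> ~ inevitable clock true.
Proof.
intros S1 inev.
pose (U := fun t : event X => exists i, t = Step i x1).
assert (U1 : forall t u, U t -> U u -> level t = level u -> t = u).
{ intros t u [i ->] [j ->] E; simpl in E; congruence. }
assert (U2 : forall t i, U t -> level t = S (S i) -> exists u, U u /\ level u = S i).
{ intros t i _ _; exists (Step i x1); split; [now exists i | easy]. }
assert (U3 : forall i x, U (Step i x) -> U (Bell i) -> steals x = false).
{ now intros i x _ [j E]. }
pose (P := canonical U1 U2 U3).
pose (st := fun i => exist U (Step i x1) (ex_intro _ i eq_refl) : trans P).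
destruct (inev P) as [[t [i ->]] Lt]; [|discriminate].
intros (Q & e & pr); apply pr.
assert (fs : forall i, foldT (extT e (st i)) = Step i x1).
{ intros i; now rewrite ext_foldT. }
assert (surT : forall t, exists i, extT e (st i) = t).
{ intros t; destruct (foldT t) as [i x | i] eqn:E; exists i.
  - apply lev_inj; unfold lev; now rewrite fs, E.
  - apply fold_shared_pre with (Guard i); rewrite ?fs, ?E; simpl;
      rewrite ?S1, Nat.eqb_refl; lia. }
split.
(* No new places either: an initial one comes from [P], and a produced one lies over a [Chain (S i)]
   already represented in [P]. *)
- intros c; destruct (init_or_produced c) as [H | [t H]].
  + now apply (ext_init_out e).
  + destruct (surT t) as [i <-]; apply fold_post in H; rewrite fs in H.
    destruct (clock_post_pos H) as (j & x & E & Ec); injection E as <- _.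
    destruct (@fold_step_post P (st i) i eq_refl) as [d Ed].
    exists d; apply foldS_inj; rewrite ext_foldS; congruence.
- intros t; destruct (surT t) as [i E]; now exists (st i).
Qed.

Lemma empty_process : exists P : process clock, ~ inhabited (trans P).
Proof.
assert (U1 : forall t u : event X, False -> False -> level t = level u -> t = u) by easy.
assert (U2 : forall (t : event X) i, False -> level t = S (S i) ->
          exists u : event X, False /\ level u = S i) by easy.
assert (U3 : forall (i : nat) x, False -> False -> steals x = false) by easy.
exists (canonical (U := fun _ => False) U1 U2 U3); now intros [[t []]].
Qed.

End Clock.

(** * The fully concurrent bisimulation *)

Section Bisimulation.
Variables (X Y : Type) (f : X -> bool) (g : Y -> bool).

Definition level_iso (P : process (clock f)) (Q : process (clock g))
    (beta : trans P -> trans Q) : Prop :=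
  finite_process P /\ finite_process Q /\ Bijective beta /\
  forall t, lev (beta t) = lev t.

Lemma level_iso_order P Q beta : @level_iso P Q beta ->
  order_isomorphism (C1 := P) (C2 := Q) beta.
Proof.
intros (_ & _ & B & L); split; [easy|]; split.
- intros t; rewrite (folding_label (proc_folding P)), (folding_label (proc_folding Q)).
  generalize (L t); unfold lev; cbn.
  now destruct (foldT t), (foldT (beta t)).
- intros t u; rewrite !flow_plus_lev, !L; reflexivity.
Qed.

Lemma level_iso_intro (P : process (clock f)) (Q : process (clock g)) :
  finite_process P ->
  (forall k, (exists t : trans P, lev t = k) <-> exists u : trans Q, lev u = k) ->
  exists beta, @level_iso P Q beta.
Proof.
intros FP H.
assert (to : forall t : trans P, {u : trans Q | lev u = lev t}).
{ intros t; apply constructive_indefinite_description, H; now exists t. }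
assert (from : forall u : trans Q, {t : trans P | lev t = lev u}).
{ intros u; apply constructive_indefinite_description, H; now exists u. }
exists (fun t => proj1_sig (to t)); split; [easy|]; split; [|split].
- apply (Finite_inj (f := fun u => proj1_sig (from u))) with (1 := FP); [easy|].
  intros u v _ _ E; apply lev_inj.
  rewrite <- (proj2_sig (from u)), <- (proj2_sig (from v)); congruence.
- exists (fun u => proj1_sig (from u)); split; intros z; apply lev_inj.
  + now rewrite (proj2_sig (from _)), (proj2_sig (to _)).
  + now rewrite (proj2_sig (to _)), (proj2_sig (from _)).
- intros t; apply (proj2_sig (to t)).
Qed.

(** [P2] is grown to the levels of [Q1]. As [f] and [g] are arbitrary, the same lemma also serves
    the backward direction. *)
Lemma level_iso_forth y0 : g y0 = false ->
  forall P1 P2 beta, @level_iso P1 P2 beta ->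
  forall (Q1 : process (clock f)) (e1 : extension P1 Q1), finite_process Q1 ->
  exists (Q2 : process (clock g)) (e2 : extension P2 Q2) beta',
    @level_iso Q1 Q2 beta' /\ extends_iso e1 e2 beta beta'.
Proof.
intros g0 P1 P2 beta (_ & F2 & [inv [_ K]] & L) Q1 e1 FQ.
(* Finiteness of [P2] enters here: [m] exceeds all its levels, so [P2] contains no [Step m x] and
   [Guard m] is intact. *)
destruct (Finite_bounded (fun t : trans P2 => lev t) F2) as [m Hm].
destruct (@grow _ g y0 g0 P2 (fun k => exists t : trans Q1, lev t = k) m)
  as (Q2 & e2 & H).
- intros u; exists (extT e1 (inv u)); rewrite <- (K u) at 2; rewrite L.
  unfold lev; now rewrite ext_foldT.
- intros i [t E]; destruct (lev_pred E) as (v & Ev & _); now exists v.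
- intros t x E; specialize (Hm t I); unfold lev in Hm; rewrite E in Hm; simpl in Hm; lia.
- destruct (level_iso_intro FQ H) as [beta' B]; exists Q2, e2, beta'; split; [easy|].
  (* The two sides have equal levels, so the new bijection extends the old one automatically. *)
  intros t; apply lev_inj; destruct B as (_ & _ & _ & L'); rewrite L'.
  generalize (L t); unfold lev; rewrite !ext_foldT; congruence.
Qed.

End Bisimulation.

Lemma clock_fcb (X Y : Type) (f : X -> bool) (g : Y -> bool) x0 y0 :
  f x0 = false -> g y0 = false -> fcb (clock f) (clock g).
Proof.
intros f0 g0; exists (@level_iso _ _ f g); split.
- intros P1 P2 beta H; assert (O := level_iso_order H); now destruct H as (? & ? & _).
- destruct (empty_process f) as [P NP], (empty_process g) as [Q NQ].
  destruct (@level_iso_intro _ _ f g P Q) as [beta B].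
  + apply (Finite_inj (f := fun _ : trans P => 0)) with (1 := Finite_lt 0);
      intros t; destruct NP; now constructor.
  + intros k; split; intros [t _]; [destruct NP | destruct NQ]; now constructor.
  + now exists P, Q, beta.
- intros P1 P2 beta H Q1 e1 FQ; now apply level_iso_forth with y0.
- intros P1 P2 beta (F1 & F2 & [inv [K1 K2]] & L) Q2 e2 FQ.
  (* Backward transfer is forward transfer for the inverse bijection; the resulting [b] is then
     inverted again. *)
  assert (H : @level_iso _ _ g f P2 P1 inv).
  { repeat split; [easy | easy | now exists beta |].
    intros u; rewrite <- (K2 u) at 2; now rewrite L. }
  destruct (level_iso_forth f0 H e2 FQ) as (Q1 & e1 & b & (FQ2 & FQ1 & [b' [K1' K2']] & L') & E).
  exists Q1, e1, b'; split.
  + repeat split; [easy | easy | now exists b |].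
    intros t; rewrite <- (K2' t) at 2; now rewrite L'.
  + intros t; rewrite <- (K1' (extT e2 (beta t))), E, K1; reflexivity.
Qed.

Theorem theorem7 :
  ~ respects_inevitability (fun (A : Type) (N1 N2 : net A) => fcb N1 N2) /\
  exists (A : Type) (N1 N2 : net A) (b : A),
    fcb N1 N2 /\
    ((inevitable N1 b /\ ~ inevitable N2 b) \/
     (inevitable N2 b /\ ~ inevitable N1 b)).
Proof.
(* In [N2] the boolean carried by a step says whether it steals, so both kinds exist at every
   position. *)
pose (N1 := clock (fun _ : unit => false)); pose (N2 := clock (fun x : bool => x)).
assert (B : fcb N1 N2) by now apply clock_fcb with tt false.
assert (I1 : inevitable N1 true) by now apply no_stealing_inevitable with tt.
assert (I2 : ~ inevitable N2 true) by now apply stealing_not_inevitable with true.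
split.
- intros H; apply I2; now apply (H bool N1 N2).
- exists bool, N1, N2, true; split; [easy | now left].
Qed.
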